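(* Let $0<a<b$ be real numbers, let $s\in(0,1)$, and let $q>1$. Then $$\left|\frac{L_{1-s}^{1-s}(a,b)}{1-s}-\frac{sG^2(a,b)L_{-1-s}^{-1-s}(a,b)+A^{1-s}(a,b)}{2(1-s)}\right|$$ $$\le \frac{A^{1-\frac1q}(a,b)}{\left(2^{2q+s}(s+1)(s+2)\right)^{1/q}}\Big\{\left[(as+a+b)b^{-sq}+\left(b\left(s2^{s+1}+1\right)+a\left(2^{s+2}-s-3\right)\right)a^{-sq}\right]^{1/q}$$ $$+\left[(bs+b+a)a^{-sq}+\left(a\left(s2^{s+1}+1\right)+b\left(2^{s+2}-s-3\right)\right)b^{-sq}\right]^{1/q}\Big\}.$$
   Context: For $0<u<v$: $A(u,v)=\frac{u+v}{2}$ (arithmetic mean), $G(u,v)=\sqrt{uv}$ (geometric mean), and for real $p\neq -1,0$, $L_p(u,v)=\left(\frac{v^{p+1}-u^{p+1}}{(p+1)(v-u)}\right)^{1/p}$ (generalized logarithmic mean). Exponents on means denote powers of their values: $A^r(u,v)=(A(u,v))^r$, $G^2(u,v)=(G(u,v))^2=uv$, and $L_p^p(u,v)=(L_p(u,v))^p=\frac{v^{p+1}-u^{p+1}}{(p+1)(v-u)}$. *)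

(* Defs.v *)
From Stdlib Require Export Reals.

Open Scope R_scope.

(* Real powers are [Rpower x y = exp (y * ln x)], the usual power for x > 0. *)

Definition A (u v : R) : R := (u + v) / 2.

Definition G (u v : R) : R := sqrt (u * v).

(* Meaningful for 0 < u < v and p <> -1, 0; the base of the outer power is
   then positive, including when p + 1 < 0. *)
Definition L (p u v : R) : R :=
  Rpower ((Rpower v (p + 1) - Rpower u (p + 1)) / ((p + 1) * (v - u))) (1 / p).

(* Main.v *)
Require Import Defs.
From Stdlib Require Import Reals.
From Stdlib Require Import Lra.
From Coquelicot Require Import Coquelicot.
Open Scope R_scope.

(** Let [f x = x^(1-s) / (1-s)], so that [f' x = x^(-s)].  The quantity inside
    the absolute value is the mean of [f] over [[a, b]] minus half the sum of
    [f (A a b)] and of [(b f(a) - a f(b)) / (b - a)], the value at 0 of the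
    chord of [f].  Integrating by parts turns it into an integral of [f']
    against a kernel that is positive on each half of [[a, b]].  In the
    variable [t] in [[0, 1/2]], with [x + t (y - x)] running from an endpoint
    [x] to the midpoint, each half becomes
      [half_error s x y = int (y - 2 t (y - x)) / 2 * (x + t (y - x))^(-s) dt],
    and the whole is [half_error s a b + half_error s b a]
    (lemma [error_eq_half_errors]).  Both terms are nonnegative, so the
    absolute value disappears and it is enough to bound one half.

    The classical bound of a half is the power mean inequality
    [int w g <= (int w)^(1-1/q) (int w g^q)^(1/q)] together with
    [z^(-sq) <= (1-t)^s x^(-sq) + t^s y^(-sq)] at [z = x + t (y - x)], which
    holds because [z^(-sq)] is convex in [z] and [t <= t^s] on [[0, 1]].  Here
    the power mean inequality is replaced by the pointwise Young inequality
    [u <= l^(1-q) u^q / q + (1 - 1/q) l] with a free parameter [l > 0]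
    ([young], [integrand_le]).  The right-hand side then has an explicit
    primitive, so comparing derivatives suffices and no integral is needed
    ([half_error_le_young]); minimising over [l] at the very end gives back
    the product of powers ([young_optimum], [half_error_le]). *)

(** * Convexity of powers and Young's inequality *)

Lemma Rpower_pos : forall x p : R, 0 < Rpower x p.
Proof. intros x p; apply exp_pos. Qed.

Lemma Rpower_2_2 : Rpower 2 2 = 4.
Proof.
  replace 2 with (INR 2) at 2 by (simpl; lra).
  rewrite Rpower_pow by lra; simpl; lra.
Qed.

Lemma exp_le_compat : forall x y : R, x <= y -> exp x <= exp y.
Proof. intros x y [H | ->]; [now apply Rlt_le, exp_increasing | apply Rle_refl]. Qed.

(** Bernoulli's inequality for a negative exponent: the graph of [r^(-p)]
    lies above its tangent at [r = 1]. *)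
Lemma Rpower_ge_tangent : forall r p : R, 0 < r -> 0 <= p ->
  1 - p * (r - 1) <= Rpower r (- p).
Proof.
  intros r p Hr Hp; unfold Rpower.
  assert (H1 := exp_ineq1_le (- p * ln r)).
  assert (H2 := exp_ineq1_le (ln r)); rewrite exp_ln in H2 by exact Hr.
  assert (H3 : p * ln r <= p * (r - 1)) by (apply Rmult_le_compat_l; lra).
  lra.
Qed.

(** Whichever endpoint has weight at least 1/2 keeps the point positive. *)
Lemma segment_pos : forall x y t : R, 0 < x -> 0 < y -> 0 <= t <= 1 ->
  0 < x + t * (y - x).
Proof. intros x y t Hx Hy Ht; destruct (Rle_or_lt t (1 / 2)); nra. Qed.

(** Both endpoint values lie above the tangent at the intermediate point [z];
    averaging the two tangent bounds makes the linear term vanish. *)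
Lemma Rpower_neg_convex : forall x y t p : R,
  0 < x -> 0 < y -> 0 <= t <= 1 -> 0 <= p ->
  Rpower (x + t * (y - x)) (- p)
  <= (1 - t) * Rpower x (- p) + t * Rpower y (- p).
Proof.
  intros x y t p Hx Hy Ht Hp.
  set (z := x + t * (y - x)).
  assert (Hz : 0 < z) by (now apply segment_pos).
  (* Tangent at [z], obtained from the one at 1 by scaling. *)
  assert (T : forall w, 0 < w ->
    Rpower z (- p) * (1 - p * (w / z - 1)) <= Rpower w (- p)).
  { intros w Hw.
    assert (Hwz : 0 < w / z) by (apply Rdiv_lt_0_compat; lra).
    replace (Rpower w (- p)) with (Rpower z (- p) * Rpower (w / z) (- p)).
    - apply Rmult_le_compat_l.
      + apply Rlt_le, Rpower_pos.
      + apply Rpower_ge_tangent; lra.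
    - rewrite Rpower_mult_distr by assumption.
      f_equal; field; lra. }
  assert (Tx := T x Hx); assert (Ty := T y Hy).
  replace (Rpower z (- p)) with
    ((1 - t) * (Rpower z (- p) * (1 - p * (x / z - 1)))
     + t * (Rpower z (- p) * (1 - p * (y / z - 1)))).
  - apply Rplus_le_compat; apply Rmult_le_compat_l; lra.
  - transitivity (Rpower z (- p) * (1 - p * ((x + t * (y - x)) / z - 1))).
    + field; lra.
    + fold z; field; lra.
Qed.

(** This is how convexity gives convexity in the second sense with exponent
    [s].  At [t = 0] it holds because [Rpower 0 s], an exponential, is
    positive. *)
Lemma le_Rpower_01 : forall t s : R, 0 <= t <= 1 -> s <= 1 ->
  t <= Rpower t s.
Proof.
  intros t s [[Ht | <-] Ht1] Hs.
  - rewrite <- (Rpower_1 t) at 1 by exact Ht.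
    unfold Rpower.
    assert (ln t <= 0) by (rewrite <- ln_1; apply ln_le; lra).
    apply exp_le_compat; nra.
  - apply Rlt_le, Rpower_pos.
Qed.

(** Weighted arithmetic-geometric inequality for [l^(1-q) u^q] and [l], whose
    geometric mean with weights [1/q] and [1 - 1/q] is [u].  After division by
    [u] both terms are exponentials whose exponents have weighted mean 0, so
    [1 + v <= exp v] applied to each gives the claim. *)
Lemma young : forall u l q : R, 0 < u -> 0 < l -> 1 < q ->
  u <= Rpower l (1 - q) / q * Rpower u q + (1 - 1 / q) * l.
Proof.
  intros u l q Hu Hl Hq.
  assert (E1 := exp_ineq1_le ((q - 1) * (ln u - ln l))).
  assert (E2 := exp_ineq1_le (- (ln u - ln l))).
  assert (Hq0 : 0 < / q) by (apply Rinv_0_lt_compat; lra).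
  assert (Hq1 : / q < 1) by (rewrite <- Rinv_1; apply Rinv_lt_contravar; lra).
  assert (P1 : Rpower l (1 - q) * Rpower u q
               = u * exp ((q - 1) * (ln u - ln l))).
  { unfold Rpower; rewrite <- (exp_ln u Hu) at 2.
    rewrite <- !exp_plus; f_equal; ring. }
  assert (P2 : l = u * exp (- (ln u - ln l))).
  { rewrite <- (exp_ln u Hu) at 1.
    rewrite <- exp_plus.
    replace (ln u + - (ln u - ln l)) with (ln l) by ring.
    now rewrite exp_ln. }
  replace (Rpower l (1 - q) / q * Rpower u q)
    with (/ q * (Rpower l (1 - q) * Rpower u q)) by (field; lra).
  rewrite P1.
  rewrite P2 at 2.
  replace (1 - 1 / q) with (1 - / q) by (field; lra).
  replace u with (u * (/ q * (1 + (q - 1) * (ln u - ln l))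
                       + (1 - / q) * (1 + - (ln u - ln l)))) at 1
    by (field; lra).
  set (e1 := exp _) in *; set (e2 := exp _) in *.
  assert (M1 := Rmult_le_compat_l (/ q) _ _ (Rlt_le _ _ Hq0) E1).
  assert (M2 := Rmult_le_compat_l (1 - / q) _ _ ltac:(lra) E2).
  assert (M3 := Rmult_le_compat_l u _ _ (Rlt_le _ _ Hu)
                  (Rplus_le_compat _ _ _ _ M1 M2)).
  lra.
Qed.

(** With [I = int w g], [W = int w] and [B = int w g^q] this is the power mean
    inequality, recovered from the linear bounds by minimising in [l]. *)
Lemma young_optimum : forall I W B q : R, 0 < W -> 0 < B -> 1 < q ->
  (forall l, 0 < l -> I <= Rpower l (1 - q) / q * B + (1 - 1 / q) * l * W) ->
  I <= Rpower W (1 - 1 / q) * Rpower B (1 / q).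
Proof.
  intros I W B q HW HB Hq H.
  (* The minimiser is [l = (B / W)^(1/q)], for which [l^(1-q) B = l W]. *)
  set (k := (ln B - ln W) / q).
  specialize (H (exp k) (exp_pos k)).
  assert (E : Rpower (exp k) (1 - q) * B = exp k * W).
  { unfold Rpower; rewrite ln_exp.
    rewrite <- (exp_ln B HB) at 1; rewrite <- (exp_ln W HW) at 1.
    rewrite <- !exp_plus; f_equal; unfold k; field; lra. }
  replace (Rpower (exp k) (1 - q) / q * B)
    with ((Rpower (exp k) (1 - q) * B) / q) in H by (field; lra).
  rewrite E in H.
  replace (Rpower W (1 - 1 / q) * Rpower B (1 / q)) with (exp k * W).
  - replace (exp k * W) with (exp k * W / q + (1 - 1 / q) * exp k * W)
      by (field; lra).
    exact H.
  - rewrite <- (exp_ln W HW) at 1.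
    unfold Rpower; rewrite <- !exp_plus; f_equal; unfold k; field; lra.
Qed.

(** * Comparing primitives *)

(** Differentiability is only asked in the open interval because primitives
    of [t^s] enter below, and [t * Rpower t s] is not handled by the rules of
    differentiation at [t = 0].  The sign of [d] is asked at the endpoints too,
    since the intermediate point of the mean value theorem used here may be
    one of them. *)
Lemma increment_nonneg : forall (D d : R -> R) (u v : R), u <= v ->
  (forall t, u < t < v -> is_derive D t (d t)) ->
  (forall t, u <= t <= v -> continuity_pt D t) ->
  (forall t, u <= t <= v -> 0 <= d t) ->
  D u <= D v.
Proof.
  intros D d u v Huv HD HC Hd.
  destruct (MVT_gen D u v d) as [c [Hc E]];
    rewrite ?Rmin_left, ?Rmax_right in * by exact Huv; auto.
  specialize (Hd c Hc); nra.
Qed.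

Lemma ex_derive_continuity_pt : forall (f : R -> R) (t : R),
  ex_derive f t -> continuity_pt f t.
Proof.
  intros f t H; apply continuity_pt_filterlim.
  exact (ex_derive_continuous (V := R_NormedModule) f t H).
Qed.

(** At 0 the factor [Rpower t s] is not continuous ([ln] is 0 on nonpositive
    numbers, so it equals 1 there), but it stays between 0 and 1 when
    [Rabs t < 1], so the product tends to 0 with [t]. *)
Lemma continuity_mult_Rpower : forall s t : R, 0 < s -> 0 <= t ->
  continuity_pt (fun t => t * Rpower t s) t.
Proof.
  intros s t Hs [Ht | <-].
  - apply ex_derive_continuity_pt.
    unfold Rpower; auto_derive; lra.
  - intros eps Heps.
    exists (Rmin 1 eps); split.
    + apply Rmin_glb_lt; lra.
    + intros x [_ Hx]; simpl in Hx |- *; unfold Rdist in *.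
      rewrite Rmult_0_l, Rminus_0_r, Rabs_mult in *.
      assert (Hx1 := Rlt_le_trans _ _ _ Hx (Rmin_l _ _)).
      assert (Hx2 := Rlt_le_trans _ _ _ Hx (Rmin_r _ _)).
      apply Rle_lt_trans with (2 := Hx2).
      rewrite <- (Rmult_1_r (Rabs x)) at 2.
      apply Rmult_le_compat_l; [apply Rabs_pos |].
      rewrite Rabs_pos_eq by apply Rlt_le, Rpower_pos.
      unfold Rpower; rewrite <- exp_0; apply exp_le_compat.
      assert (ln x <= 0).
      { destruct (Rlt_or_le 0 x) as [Hp | Hn].
        - rewrite <- ln_1; apply ln_le; [exact Hp |].
          rewrite Rabs_pos_eq in Hx1; lra.
        - unfold ln; destruct (Rlt_dec 0 x); [exfalso |]; lra. }
      nra.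
Qed.

(** * The error as a sum of two half-interval integrals *)

(** A primitive in [t] of [weight x y t * z^(-s)], found by writing the weight
    as [(y + 2 x - 2 z) / 2]; the powers [z^(1-s)] and [z^(2-s)] are kept as
    polynomials times [z^(-s)] so that [field] can compare them. *)
Definition half_primitive (s x y t : R) : R :=
  let z := x + t * (y - x) in
  ((y + 2 * x) / (2 * (1 - s)) * z - z ^ 2 / (2 - s)) * Rpower z (- s) / (y - x).

(** The integral of [weight x y t * (x + t (y - x))^(-s)] over [[0, 1/2]]. *)
Definition half_error (s x y : R) : R :=
  half_primitive s x y (1 / 2) - half_primitive s x y 0.

(** The kernel produced by integration by parts.  It is affine, from [y / 2]
    at the endpoint [x] to [x / 2] at the midpoint; on the other half of the
    interval the kernel is the same with [x] and [y] exchanged. *)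
Definition weight (x y t : R) : R := (y - 2 * t * (y - x)) / 2.

Lemma weight_nonneg : forall x y t : R, 0 < x -> 0 < y -> 0 <= t <= 1 / 2 ->
  0 <= weight x y t.
Proof. intros x y t Hx Hy Ht; unfold weight; nra. Qed.

Lemma is_derive_half_primitive : forall s x y t : R,
  0 < s < 1 -> x <> y -> 0 < x + t * (y - x) ->
  is_derive (half_primitive s x y) t
    (weight x y t * Rpower (x + t * (y - x)) (- s)).
Proof.
  intros s x y t Hs Hxy Hz; unfold half_primitive, weight, Rpower.
  auto_derive; [exact Hz |].
  field; repeat split; lra.
Qed.

Lemma half_error_nonneg : forall s x y : R,
  0 < s < 1 -> 0 < x -> 0 < y -> x <> y -> 0 <= half_error s x y.
Proof.
  intros s x y Hs Hx Hy Hxy; unfold half_error.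
  assert (Hz : forall t, 0 <= t <= 1 / 2 -> 0 < x + t * (y - x))
    by (intros; apply segment_pos; lra).
  apply -> Rminus_le_0.
  apply
    (increment_nonneg _ (fun t => weight x y t * Rpower (x + t * (y - x)) (- s))).
  - lra.
  - intros t Ht; apply is_derive_half_primitive; auto; apply Hz; lra.
  - intros t Ht.
    apply ex_derive_continuity_pt.
    eexists; apply is_derive_half_primitive; auto.
  - intros t Ht; apply Rmult_le_pos.
    + now apply weight_nonneg.
    + apply Rlt_le, Rpower_pos.
Qed.

(** * Bounding one half *)

(** The [q]-th moment bound
    [int weight * ((1-t)^s x^(-sq) + t^s y^(-sq))] over [[0, 1/2]], multiplied
    by [4 * 2^s (s+1) (s+2)]. *)
Definition moment_bound (s q x y : R) : R :=
  (x * s + x + y) * Rpower y (- s * q)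
  + (y * (s * Rpower 2 (s + 1) + 1)
     + x * (Rpower 2 (s + 2) - s - 3)) * Rpower x (- s * q).

Lemma integrand_le : forall s q x y t l : R,
  0 < s < 1 -> 1 < q -> 0 < x -> 0 < y -> 0 <= t <= 1 / 2 -> 0 < l ->
  Rpower (x + t * (y - x)) (- s)
  <= Rpower l (1 - q) / q
       * (Rpower (1 - t) s * Rpower x (- s * q) + Rpower t s * Rpower y (- s * q))
     + (1 - 1 / q) * l.
Proof.
  intros s q x y t l Hs Hq Hx Hy Ht Hl.
  set (z := x + t * (y - x)).
  eapply Rle_trans; [apply (young (Rpower z (- s)) l q); auto; apply Rpower_pos |].
  apply Rplus_le_compat_r, Rmult_le_compat_l.
  - apply Rlt_le, Rdiv_lt_0_compat; [apply Rpower_pos | lra].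
  - rewrite Rpower_mult.
    replace (- s * q) with (- (s * q)) by ring.
    eapply Rle_trans.
    + apply Rpower_neg_convex; try lra; nra.
    + apply Rplus_le_compat; apply Rmult_le_compat_r;
        try apply Rlt_le, Rpower_pos; apply le_Rpower_01; lra.
Qed.

(** Integrating [integrand_le] against the weight: the moments of [t^s] and
    [(1-t)^s] make up [moment_bound], and the total weight is [A x y / 4]. *)
Lemma half_error_le_young : forall s q x y l : R,
  0 < s < 1 -> 1 < q -> 0 < x -> 0 < y -> x <> y -> 0 < l ->
  half_error s x y
  <= Rpower l (1 - q) / q
       * (moment_bound s q x y / (4 * Rpower 2 s * (s + 1) * (s + 2)))
     + (1 - 1 / q) * l * (A x y / 4).
Proof.
  intros s q x y l Hs Hq Hx Hy Hxy Hl.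
  set (c := Rpower l (1 - q) / q).
  set (d := (1 - 1 / q) * l).
  set (X := Rpower x (- s * q)).
  set (Y := Rpower y (- s * q)).
  (* [D] is the primitive of the upper bound minus that of the integrand; only
     its first summand, the primitive of the [t^s] term, is singular at 0. *)
  set (smooth := fun t : R =>
    c * X * (- (((1 - t) * Rpower (1 - t) s)
           * ((2 * x - y) / (2 * (s + 1)) + (1 - t) * (y - x) / (s + 2))))
    + d * (y * t / 2 - t ^ 2 * (y - x) / 2) - half_primitive s x y t).
  set (D := fun t : R =>
    (t * Rpower t s) * (c * Y * (y / (2 * (s + 1)) - t * (y - x) / (s + 2)))
    + smooth t).
  set (dsmooth := fun t : R =>
    weight x y t * (c * (Rpower (1 - t) s * X) + d
                    - Rpower (x + t * (y - x)) (- s))).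
  assert (Hz : forall t, 0 <= t <= 1 / 2 -> 0 < x + t * (y - x))
    by (intros; apply segment_pos; lra).
  assert (Hsm : forall t, 0 <= t <= 1 / 2 -> is_derive smooth t (dsmooth t)).
  { intros t Ht; unfold smooth, dsmooth.
    rewrite Rmult_minus_distr_l.
    apply (is_derive_minus (V := R_NormedModule) (K := R_AbsRing)).
    - unfold Rpower, weight; auto_derive; [lra |].
      replace (1 + - t) with (1 - t) by ring.
      field; lra.
    - apply is_derive_half_primitive; auto. }
  assert (HD : D 0 <= D (1 / 2)).
  { apply (increment_nonneg D (fun t =>
      weight x y t * (c * (Rpower (1 - t) s * X + Rpower t s * Y) + d
                      - Rpower (x + t * (y - x)) (- s)))).
    - lra.
    - intros t Ht.
      replace (weight x y t * _) with
        (weight x y t * (c * (Rpower t s * Y)) + dsmooth t)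
        by (unfold dsmooth; ring).
      apply (is_derive_plus (V := R_NormedModule) (K := R_AbsRing)).
      + unfold Rpower, weight; auto_derive; [lra |].
        field; lra.
      + apply Hsm; lra.
    - intros t Ht; unfold D.
      apply (continuity_pt_plus (fun t => t * Rpower t s * _)).
      + apply (continuity_pt_mult (fun t => t * Rpower t s)).
        * apply continuity_mult_Rpower; lra.
        * apply ex_derive_continuity_pt.
          auto_derive; auto.
      + apply ex_derive_continuity_pt.
        eexists; apply Hsm; exact Ht.
    - intros t Ht; apply Rmult_le_pos.
      + now apply weight_nonneg.
      + apply -> Rminus_le_0; apply integrand_le; auto. }
  assert (H2 : Rpower (1 / 2) s = / Rpower 2 s).
  { unfold Rpower; rewrite <- exp_Ropp; f_equal.
    unfold Rdiv; rewrite Rmult_1_l, ln_Rinv by lra; ring. }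
  assert (H1 : Rpower 1 s = 1)
    by (unfold Rpower; rewrite ln_1, Rmult_0_r; apply exp_0).
  unfold D, smooth in HD.
  rewrite Rminus_0_r, H1 in HD.
  replace (1 - 1 / 2) with (1 / 2) in HD by field.
  rewrite H2 in HD.
  assert (P := Rpower_pos 2 s).
  unfold half_error, moment_bound, A; fold X Y.
  rewrite !Rpower_plus, Rpower_1, Rpower_2_2 by lra.
  apply Rminus_le_0 in HD.
  apply Rminus_le_0.
  match type of HD with 0 <= ?e => apply Rle_trans with e; [exact HD |] end.
  apply Req_le; field; lra.
Qed.

Lemma moment_bound_pos : forall s q x y : R, 0 < s < 1 -> 0 < x -> 0 < y ->
  0 < moment_bound s q x y.
Proof.
  intros s q x y Hs Hx Hy; unfold moment_bound.
  assert (H : 1 <= Rpower 2 s).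
  { replace 1 with (Rpower 2 0) by (apply Rpower_O; lra).
    apply Rle_Rpower; lra. }
  rewrite !Rpower_plus, Rpower_1, Rpower_2_2 by lra.
  assert (Hsum : 0 < y * (s * (Rpower 2 s * 2) + 1)
                     + x * (Rpower 2 s * 4 - s - 3))
    by (apply Rplus_lt_0_compat; apply Rmult_lt_0_compat; nra).
  apply Rplus_lt_0_compat; apply Rmult_lt_0_compat; try apply Rpower_pos;
    [nra | exact Hsum].
Qed.

Lemma half_error_le : forall s q x y : R,
  0 < s < 1 -> 1 < q -> 0 < x -> 0 < y -> x <> y ->
  half_error s x y
  <= Rpower (A x y) (1 - 1 / q)
     / Rpower (Rpower 2 (2 * q + s) * (s + 1) * (s + 2)) (1 / q)
     * Rpower (moment_bound s q x y) (1 / q).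
Proof.
  intros s q x y Hs Hq Hx Hy Hxy.
  assert (HE := moment_bound_pos s q x y Hs Hx Hy).
  assert (HA : 0 < A x y) by (unfold A; lra).
  assert (P := Rpower_pos 2 s).
  assert (HD : 0 < 4 * Rpower 2 s * (s + 1) * (s + 2))
    by (repeat apply Rmult_lt_0_compat; lra).
  eapply Rle_trans.
  - apply (young_optimum _ (A x y / 4)
      (moment_bound s q x y / (4 * Rpower 2 s * (s + 1) * (s + 2))) q).
    + lra.
    + now apply Rdiv_lt_0_compat.
    + exact Hq.
    + intros l Hl; now apply half_error_le_young.
  - apply Req_le.
    assert (H4 : ln 4 = 2 * ln 2)
      by (replace 4 with (2 * 2) by ring; rewrite ln_mult by lra; ring).
    assert (P' := Rpower_pos 2 (2 * q + s)).
    assert (L1 : ln (4 * Rpower 2 s * (s + 1) * (s + 2))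
                 = 2 * ln 2 + s * ln 2 + ln (s + 1) + ln (s + 2)).
    { rewrite !ln_mult, H4 by (repeat apply Rmult_lt_0_compat; lra).
      unfold Rpower; rewrite ln_exp; ring. }
    assert (L2 : ln (Rpower 2 (2 * q + s) * (s + 1) * (s + 2))
                 = (2 * q + s) * ln 2 + ln (s + 1) + ln (s + 2)).
    { rewrite !ln_mult by (repeat apply Rmult_lt_0_compat; lra).
      unfold Rpower; rewrite ln_exp; ring. }
    (* The factors [(1/4)^(1-1/q)] and [(1/4)^(1/q)] of the two powers combine
       to [1/4 = (2^(2q))^(-1/q)]; taking logarithms makes this linear. *)
    unfold Rdiv at 5; rewrite <- Rpower_Ropp.
    unfold Rpower at 1 2 4 5 7.
    rewrite L2, <- !exp_plus, !ln_div, L1, H4 by lra.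
    f_equal; field; lra.
Qed.

(** * The error identity and the theorem *)

(** Integration by parts in closed form: [L_(1-s)^(1-s)] and
    [L_(-1-s)^(-1-s)] are rational in [a], [b], [a^(-s)], [b^(-s)], the powers
    of the midpoint coming from the two halves combine, and the rest is an
    identity of rational functions. *)
Lemma error_eq_half_errors : forall a b s : R,
  0 < a -> a < b -> 0 < s < 1 ->
  Rpower (L (1 - s) a b) (1 - s) / (1 - s)
  - (s * G a b ^ 2 * Rpower (L (-1 - s) a b) (-1 - s)
     + Rpower (A a b) (1 - s)) / (2 * (1 - s))
  = half_error s a b + half_error s b a.
Proof.
  intros a b s Ha Hab Hs.
  assert (S : forall z, 0 < z -> Rpower z (1 - s) = z * Rpower z (- s)).
  { intros z Hz; unfold Rminus; now rewrite Rpower_plus, Rpower_1. }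
  assert (Hlt : Rpower b (- s) < Rpower a (- s)).
  { unfold Rpower; apply exp_increasing.
    assert (ln a < ln b) by (apply ln_increasing; lra); nra. }
  assert (Pb := Rpower_pos b (- s)).
  assert (L1 : Rpower (L (1 - s) a b) (1 - s)
               = (b ^ 2 * Rpower b (- s) - a ^ 2 * Rpower a (- s))
                 / ((2 - s) * (b - a))).
  { unfold L; rewrite Rpower_mult.
    replace (1 / (1 - s) * (1 - s)) with 1 by (field; lra).
    replace (1 - s + 1) with (2 - s) by ring.
    assert (M : Rpower a (2 - s) < Rpower b (2 - s))
      by (apply Rlt_Rpower_l; lra).
    rewrite Rpower_1
      by (apply Rdiv_lt_0_compat; [| apply Rmult_lt_0_compat]; lra).
    replace (2 - s) with (1 + (1 - s)) by ring.
    rewrite !(Rpower_plus 1), !Rpower_1, !S by lra.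
    field; lra. }
  assert (L2 : Rpower (L (-1 - s) a b) (-1 - s)
               = (Rpower a (- s) - Rpower b (- s)) / (s * (b - a))).
  { unfold L; rewrite Rpower_mult.
    replace (1 / (-1 - s) * (-1 - s)) with 1 by (field; lra).
    replace (-1 - s + 1) with (- s) by ring.
    replace ((Rpower b (- s) - Rpower a (- s)) / (- s * (b - a)))
      with ((Rpower a (- s) - Rpower b (- s)) / (s * (b - a))) by (field; lra).
    apply Rpower_1, Rdiv_lt_0_compat; [lra |].
    apply Rmult_lt_0_compat; lra. }
  assert (HG : G a b ^ 2 = a * b) by (unfold G; apply pow2_sqrt; nra).
  rewrite L1, L2, HG, S by (unfold A; lra).
  unfold half_error, half_primitive, A.
  replace (a + 1 / 2 * (b - a)) with ((a + b) / 2) by field.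
  replace (b + 1 / 2 * (a - b)) with ((a + b) / 2) by field.
  rewrite !Rmult_0_l, !Rplus_0_r.
  field; repeat split; lra.
Qed.

Theorem proposition6 : forall (a b s q : R),
  0 < a -> a < b -> 0 < s -> s < 1 -> 1 < q ->
  Rabs (Rpower (L (1 - s) a b) (1 - s) / (1 - s)
        - (s * G a b ^ 2 * Rpower (L (-1 - s) a b) (-1 - s)
           + Rpower (A a b) (1 - s)) / (2 * (1 - s)))
  <= Rpower (A a b) (1 - 1 / q)
     / Rpower (Rpower 2 (2 * q + s) * (s + 1) * (s + 2)) (1 / q)
     * (Rpower ((a * s + a + b) * Rpower b (- s * q)
                + (b * (s * Rpower 2 (s + 1) + 1)
                   + a * (Rpower 2 (s + 2) - s - 3)) * Rpower a (- s * q))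
               (1 / q)
        + Rpower ((b * s + b + a) * Rpower a (- s * q)
                  + (a * (s * Rpower 2 (s + 1) + 1)
                     + b * (Rpower 2 (s + 2) - s - 3)) * Rpower b (- s * q))
                 (1 / q)).
Proof.
  intros a b s q Ha Hab Hs0 Hs1 Hq.
  assert (Hs : 0 < s < 1) by lra.
  rewrite error_eq_half_errors by assumption.
  rewrite Rabs_pos_eq
    by (apply Rplus_le_le_0_compat; apply half_error_nonneg; lra).
  rewrite Rmult_plus_distr_l.
  apply Rplus_le_compat.
  - apply (half_error_le s q a b); lra.
  - replace (A a b) with (A b a) by (unfold A; field).
    apply (half_error_le s q b a); lra.
Qed.
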